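(* Let $0<\alpha\le 1$, $\beta>0$, let $i\ge 1$ be an integer, let $a,b\in\mathbb{R}$, and let $f,g:[0,\infty)\to\mathbb{R}$ be $\alpha$-differentiable at a point $t>0$. Then: 1. ${}_{i}\mathscr{D}_{M}^{\alpha,\beta}(af+bg)(t)=a\,{}_{i}\mathscr{D}_{M}^{\alpha,\beta}f(t)+b\,{}_{i}\mathscr{D}_{M}^{\alpha,\beta}g(t)$. 2. ${}_{i}\mathscr{D}_{M}^{\alpha,\beta}(f\cdot g)(t)=f(t)\,{}_{i}\mathscr{D}_{M}^{\alpha,\beta}g(t)+g(t)\,{}_{i}\mathscr{D}_{M}^{\alpha,\beta}f(t)$. 3. If $g(t)\ne 0$, then ${}_{i}\mathscr{D}_{M}^{\alpha,\beta}\left(\frac{f}{g}\right)(t)=\dfrac{g(t)\,{}_{i}\mathscr{D}_{M}^{\alpha,\beta}f(t)-f(t)\,{}_{i}\mathscr{D}_{M}^{\alpha,\beta}g(t)}{[g(t)]^{2}}$. 4. ${}_{i}\mathscr{D}_{M}^{\alpha,\beta}(c)=0$, where $c$ denotes a constant function $f(t)=c$. 5. (Chain rule) If $f$ is differentiable at $t$, then ${}_{i}\mathscr{D}_{M}^{\alpha,\beta}f(t)=\dfrac{t^{1-\alpha}}{\Gamma(\beta+1)}\dfrac{df(t)}{dt}$. 6. If $g$ takes values in $[0,\infty)$ (so that $f\circ g$ is defined) and $f$ is differentiable at $g(t)$, then ${}_{i}\mathscr{D}_{M}^{\alpha,\beta}(f\circ g)(t)=f'(g(t))\,{}_{i}\mathscr{D}_{M}^{\alpha,\beta}g(t)$.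 (In each item the derivative on the left-hand side exists.)
   Context: For an integer $i\ge 1$ and $\beta>0$, the truncated Mittag-Leffler function of one parameter is ${}_{i}\mathbb{E}_{\beta}(z)=\sum_{k=0}^{i}\frac{z^{k}}{\Gamma(\beta k+1)}$, $z\in\mathbb{C}$, where $\Gamma$ is the Gamma function. For $f:[0,\infty)\to\mathbb{R}$ and $t>0$, the truncated $M$-fractional derivative of $f$ of order $\alpha$ at $t$ is $${}_{i}\mathscr{D}_{M}^{\alpha,\beta}f(t):=\lim_{\varepsilon\to 0}\frac{f\left(t\,{}_{i}\mathbb{E}_{\beta}(\varepsilon t^{-\alpha})\right)-f(t)}{\varepsilon},$$ where $\varepsilon$ is real, whenever this limit exists (as a real number). In that case $f$ is called $\alpha$-differentiable at $t$ (with the parameters $i$ and $\beta$ fixed). The same definition applies to functions defined only in a neighbourhood of $t$, such as $f/g$ when $g(t)\neq 0$. *)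

(* Defs.v *)
From mathcomp Require Import all_boot all_order all_algebra.
From mathcomp Require Import all_classical all_reals all_analysis.

Set Implicit Arguments.
Unset Strict Implicit.
Unset Printing Implicit Defensive.

Import Order.TTheory GRing.Theory Num.Theory.
Import numFieldTopology.Exports numFieldNormedType.Exports.

Local Open Scope classical_set_scope.
Local Open Scope ring_scope.

(* Euler's integral; it converges for every s > 0. *)
Definition Gamma (R : realType) (s : R) : R :=
  \int[lebesgue_measure]_(x in `]0, +oo[) (x `^ (s - 1) * expR (- x)).

(* Only real arguments are needed: the coefficients are real and the
   fractional derivative evaluates the function at eps * t ^ (- alpha). *)
Definition truncML (R : realType) (i : nat) (beta z : R) : R :=
  \sum_(0 <= k < i.+1) z ^+ k / Gamma (beta * k%:R + 1).

(* A function on [0, +oo[ is represented by an arbitrary total extension to R.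
   Near eps = 0 the point t * E(eps * t ^ (- alpha)) is close to t > 0, so the
   values of f at negative points do not influence the limit below. *)
Definition Mquot (R : realType) (i : nat) (alpha beta : R) (f : R -> R)
    (t eps : R) : R :=
  (f (t * truncML i beta (eps * t `^ (- alpha))) - f t) / eps.

Definition Mderivable (R : realType) (i : nat) (alpha beta : R) (f : R -> R)
    (t : R) : Prop :=
  cvg (Mquot i alpha beta f t eps @[eps --> 0^']).

(* Meaningful only under [Mderivable]: [lim] is an arbitrary value when the
   limit does not exist. *)
Definition Mderive (R : realType) (i : nat) (alpha beta : R) (f : R -> R)
    (t : R) : R :=
  lim (Mquot i alpha beta f t eps @[eps --> 0^']).

(* Ordinary differentiability at x >= 0 of a function whose domain is
   [0, +oo[: the increments stay in the domain, so that this is the one-sided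
   derivative at x = 0, and the usual one at x > 0 (lemmas below). *)
Definition derivable_nneg (R : realType) (f : R -> R) (x : R) : Prop :=
  cvg ((f y - f x) / (y - x) @[y --> within `[0, +oo[ x^']).

Definition derive_nneg (R : realType) (f : R -> R) (x : R) : R :=
  lim ((f y - f x) / (y - x) @[y --> within `[0, +oo[ x^']).

Lemma quot_nnegE (R : realType) (f : R -> R) (x : R) : 0 < x ->
  (f y - f x) / (y - x) @[y --> within `[0, +oo[ x^'] =
  h^-1 *: (f (h + x) - f x) @[h --> 0^'].
Proof.
move=> x0; apply: funext => P; apply: propext.
have xpos : \forall y \near x, 0 < y by exact: lt_nbhsr.
change ((\forall y \near x, y != x -> [set` `[0, +oo[] y ->
           P ((f y - f x) / (y - x))) <->
        (\forall h \near 0, h != 0 -> P (h^-1 *: (f (h + x) - f x)))).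
have Pq h : (f (h + x) - f x) / (h + x - x) = h^-1 *: (f (h + x) - f x).
  by rewrite addrK mulrC.
have nE h : (h + x != x) = (h != 0) by rewrite -subr_eq0 addrK.
move: xpos; rewrite !(near_shift 0 x) subr0 => xpos.
split=> H; apply: filterS2 xpos H => h /= hx; rewrite ?nE ?Pq => H h0 //.
- by apply: H => //; rewrite in_itv/= (ltW hx).
- by move=> _; exact: H.
Qed.

Lemma derivable_nnegE (R : realType) (f : R -> R) (x : R) : 0 < x ->
  derivable_nneg f x <-> derivable f x 1.
Proof.
move=> x0; rewrite /derivable_nneg quot_nnegE// /derivable.
by under [in X in _ <-> X]eq_fun do rewrite /= [_ *: 1]mulr1.
Qed.

Lemma derive_nnegE (R : realType) (f : R -> R) (x : R) : 0 < x ->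
  derive_nneg f x = derive1 f x.
Proof. by move=> x0; rewrite /derive_nneg quot_nnegE. Qed.

(* Main.v *)
Require Import Defs.
From mathcomp Require Import all_boot all_order all_algebra.
From mathcomp Require Import all_classical all_reals all_analysis.
From mathcomp Require Import ring.

Import Order.TTheory GRing.Theory Num.Theory.
Import numFieldTopology.Exports numFieldNormedType.Exports.

Local Open Scope classical_set_scope.
Local Open Scope ring_scope.

(** Along the path u(eps) = t * E(eps * t ^ (- alpha)), the quotient defining
    the M-derivative of f is the ordinary difference quotient at eps = 0 of
    f composed with u, as soon as u(0) = t.  The latter amounts to
    Gamma(1) = 1, the integral of the standard exponential density.  Hence:

    - An M-differentiable f is continuous along u ([cvg_path_Mquot]), which is
      all that the usual proofs of the product and quotient rules require of
      u; the sum rule only needs the linearity of limits.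

    - The chain rule is proved once, for composition along an arbitrary
      filter ([cvg_quot_comp]), by Caratheodory's device.  Its hypothesis on
      the outer function is a limit within a domain D, so that it covers the
      one-sided derivative at the point 0 of [0, +oo[.

    - The path u itself has velocity t ^ (1 - alpha) / Gamma(beta + 1) at
      eps = 0 ([cvg_Mquot_id]): E is a polynomial whose linear coefficient is
      1 / Gamma(beta + 1).  The formula for ordinary differentiable functions
      is then the chain rule applied to the inner function g = id. *)

Section QuotientsAlongFilters.
Context {R : realType} {T : Type} {F : set_system T} {FF : Filter F}.

(** The extension of the difference quotient of f by its limit l at x0 is
    continuous at x0 relatively to D (Caratheodory), and multiplying it by
    u - x0 gives back the increment of f even at points where u = x0, where
    the naive cancellation fails. *)
Lemma cvg_quot_comp (D : set R) (f : R -> R) (u e : T -> R) (x0 l m : R) :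
  (f y - f x0) / (y - x0) @[y --> within D x0^'] --> l ->
  u s @[s --> F] --> x0 -> (\forall s \near F, D (u s)) ->
  (u s - x0) / e s @[s --> F] --> m ->
  (f (u s) - f x0) / e s @[s --> F] --> l * m.
Proof.
move=> fl ux Du um.
pose phi y := if y == x0 then l else (f y - f x0) / (y - x0).
have phil : phi (u s) @[s --> F] --> l.
  move=> P Pl; have Pphi : \forall y \near x0, D y -> P (phi y).
    have Pq : \forall y \near x0, y != x0 -> D y ->
        P ((f y - f x0) / (y - x0)) by exact: fl.
    apply: filterS Pq => y Py Dy; rewrite /phi.
    by case: eqVneq => [_|yx0]; [exact: nbhs_singleton|exact: Py].
  have uphi : \forall s \near F, D (u s) -> P (phi (u s)).
    exact: (ux _ Pphi).
  by apply: filterS2 uphi Du => s Hs Ds; exact: Hs.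
have -> : (fun s => (f (u s) - f x0) / e s) =
          (fun s => phi (u s) * ((u s - x0) / e s)).
  apply/funext => s; rewrite /phi; case: eqVneq => [->|ux0].
    by rewrite !subrr !mul0r mulr0.
  by rewrite mulrA divfK// subr_eq0.
exact: cvgM.
Qed.

End QuotientsAlongFilters.

Section MDerivative.
Context {R : realType} {i : nat} {alpha beta t : R}.

Local Notation u := (fun eps => t * truncML i beta (eps * t `^ (- alpha))).
Local Notation Mq f := (Mquot i alpha beta f t).

Lemma cvg_MquotP (f : R -> R) (l : R) : Mq f eps @[eps --> 0^'] --> l ->
  Mderivable i alpha beta f t /\ Mderive i alpha beta f t = l.
Proof.
by move=> fl; split; [apply/cvg_ex; exists l|apply: cvg_lim].
Qed.

(** Continuity of f along the path: its increment is eps times a convergent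
    quotient. *)
Lemma cvg_path_Mquot (f : R -> R) (l : R) :
  Mq f eps @[eps --> 0^'] --> l -> f (u eps) @[eps --> 0^'] --> f t.
Proof.
move=> fl.
have e0 : (eps : R) @[eps --> 0^'] --> (0 : R) by exact: nbhs_dnbhs.
have : f t + eps * Mq f eps @[eps --> 0^'] --> f t.
  rewrite -[X in _ --> X]addr0 -[X in _ --> _ + X](mul0r l).
  by apply: cvgD; [exact: cvg_cst|exact: cvgM].
apply: cvg_trans; apply: near_eq_cvg.
near=> eps; rewrite /Mquot /= mulrC divfK ?subrKC//.
by near: eps; exact: nbhs_dnbhs_neq.
Unshelve. all: by end_near. Qed.

Lemma cvg_MquotD (a b l m : R) (f g : R -> R) :
  Mq f eps @[eps --> 0^'] --> l -> Mq g eps @[eps --> 0^'] --> m ->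
  Mq (fun x => a * f x + b * g x) eps @[eps --> 0^'] --> a * l + b * m.
Proof.
move=> fl gm.
have -> : Mq (fun x => a * f x + b * g x) =
          (fun eps => a * Mq f eps + b * Mq g eps).
  by apply/funext => eps; rewrite /Mquot; ring.
by apply: cvgD; apply: cvgM => //; exact: cvg_cst.
Qed.

Lemma cvg_MquotM (l m : R) (f g : R -> R) :
  Mq f eps @[eps --> 0^'] --> l -> Mq g eps @[eps --> 0^'] --> m ->
  Mq (fun x => f x * g x) eps @[eps --> 0^'] --> f t * m + g t * l.
Proof.
move=> fl gm.
have -> : Mq (fun x => f x * g x) =
          (fun eps => f (u eps) * Mq g eps + g t * Mq f eps).
  by apply/funext => eps; rewrite /Mquot; ring.
apply: cvgD; first exact: cvgM (cvg_path_Mquot _ _ fl) gm.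
by apply: cvgM => //; exact: cvg_cst.
Qed.

Lemma cvg_Mquot_div (l m : R) (f g : R -> R) : g t != 0 ->
  Mq f eps @[eps --> 0^'] --> l -> Mq g eps @[eps --> 0^'] --> m ->
  Mq (fun x => f x / g x) eps @[eps --> 0^'] -->
    (g t * l - f t * m) / g t ^+ 2.
Proof.
move=> gt0 fl gm; have gu := cvg_path_Mquot _ _ gm.
have : (g t * Mq f eps - f t * Mq g eps) / (g (u eps) * g t)
    @[eps --> 0^'] --> (g t * l - f t * m) / g t ^+ 2.
  apply: cvgM.
    by apply: cvgB; apply: cvgM => //; exact: cvg_cst.
  by apply: cvgV; rewrite ?expf_neq0//; apply: cvgM => //; exact: cvg_cst.
apply: cvg_trans; apply: near_eq_cvg.
near=> eps.
have gu0 : g (u eps) != 0 by near: eps; exact: cvgr_neq0 gu gt0.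
have eps0 : eps != 0 by near: eps; exact: nbhs_dnbhs_neq.
by rewrite /Mquot /=; field; rewrite gu0 gt0 eps0.
Unshelve. all: by end_near. Qed.

Lemma cvg_Mquot_cst (c : R) : Mq (fun=> c) eps @[eps --> 0^'] --> 0.
Proof.
have -> : Mq (fun=> c) = fun=> 0.
  by apply/funext => eps; rewrite /Mquot subrr mul0r.
exact: cvg_cst.
Qed.

End MDerivative.

Lemma Gamma1 (R : realType) : Gamma (1 : R) = 1.
Proof.
pose e := exponential_pdf (1 : R).
have ie : lebesgue_measure.-integrable `]0, +oo[ (EFin \o e).
  exact: integrableS (integrable_exponential_pdf (ltr01 : (0 : R) < 1)).
have -> : Gamma 1 = \int[lebesgue_measure]_(x in `]0, +oo[) e x.
  apply: eq_Rintegral => x; rewrite inE /= in_itv /= andbT => x0.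
  by rewrite /e subrr powRr0 exponential_pdfE ?ltW// mulN1r.
rewrite Rintegral_itv_obnd_cbnd// Rintegral_mkcond.
(* The density already vanishes outside [0, +oo[. *)
have -> : e \_ `[0, +oo[ = e.
  by rewrite /e /exponential_pdf -patch_setI setIid.
by rewrite /Rintegral integral_exponential_pdf.
Qed.

(** Here Gamma(1) = 1 enters: the constant coefficient is 1.  The remaining
    factor is a polynomial in z, so the difference quotient of the truncated
    Mittag-Leffler function at 0 tends to its linear coefficient. *)
Lemma truncML_expand (R : realType) (n : nat) (beta z : R) :
  truncML n.+1 beta z =
  1 + z * (\poly_(k < n.+1) (Gamma (beta * k.+1%:R + 1))^-1).[z].
Proof.
rewrite /truncML big_nat_recl// expr0 mulr0 add0r Gamma1 invr1 mulr1.
rewrite horner_poly mulr_sumr big_mkord; congr (1 + _).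
by apply: eq_bigr => k _; rewrite exprS; ring.
Qed.

Lemma cvg_Mquot_id (R : realType) (i : nat) (alpha beta t : R) :
  (1 <= i)%N -> 0 < t ->
  Mquot i alpha beta id t eps @[eps --> 0^'] -->
    t `^ (1 - alpha) / Gamma (beta + 1).
Proof.
case: i => // n _ t0.
pose q := \poly_(k < n.+1) (Gamma (beta * k.+1%:R + 1))^-1.
set c := t `^ (- alpha).
have ec : eps * c @[eps --> 0^'] --> (0 : R).
  rewrite -[X in _ --> X](mul0r c); apply: cvgM; last exact: cvg_cst.
  exact: nbhs_dnbhs.
have qc : q.[eps * c] @[eps --> 0^'] --> q.[0].
  apply: (cvg_comp (fun eps => eps * c) (horner q) ec).
  exact: continuous_horner.
have -> : t `^ (1 - alpha) / Gamma (beta + 1) = t * c * q.[0].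
  rewrite powRD ?(gt_eqF t0) ?implybT// powRr1 ?ltW//.
  by rewrite horner_coef0 coef_poly /= mulr1.
have : t * c * q.[eps * c] @[eps --> 0^'] --> t * c * q.[0].
  by apply: cvgM => //; exact: cvg_cst.
apply: cvg_trans; apply: near_eq_cvg.
near=> eps.
have eps0 : eps != 0 by near: eps; exact: nbhs_dnbhs_neq.
by rewrite /Mquot truncML_expand -/q -/c /=; field.
Unshelve. all: by end_near. Qed.

(** The path stays in the domain [0, +oo[ near eps = 0, since it tends to
    t > 0; so does its image under g. *)
Lemma cvg_Mquot_comp (R : realType) (i : nat) (alpha beta t l m : R)
    (f g : R -> R) : (1 <= i)%N -> 0 < t ->
  (forall x, 0 <= x -> 0 <= g x) ->
  (f y - f (g t)) / (y - g t) @[y --> within `[0, +oo[ (g t)^'] --> l ->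
  Mquot i alpha beta g t eps @[eps --> 0^'] --> m ->
  Mquot i alpha beta (f \o g) t eps @[eps --> 0^'] --> l * m.
Proof.
move=> i1 t0 g0 fl gm.
apply: (cvg_quot_comp _ _ _ _ _ _ _ fl (cvg_path_Mquot _ _ gm)) => //.
(* Continuity of the path itself is continuity of id along it. *)
have ut := cvg_path_Mquot _ _ (cvg_Mquot_id _ _ alpha beta _ i1 t0).
apply: filterS (cvgr_gt t ut 0 t0) => eps u0.
by rewrite /= in_itv /= andbT; apply/g0/ltW.
Qed.

Theorem theorem2 (R : realType) (i : nat) (alpha beta a b t : R) (f g : R -> R)
    (hi : (1 <= i)%N) (halpha0 : 0 < alpha) (halpha1 : alpha <= 1)
    (hbeta : 0 < beta) (ht : 0 < t)
    (hf : Mderivable i alpha beta f t) (hg : Mderivable i alpha beta g t) :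
  (* 1 *)
  (Mderivable i alpha beta (fun x => a * f x + b * g x) t /\
   Mderive i alpha beta (fun x => a * f x + b * g x) t =
     a * Mderive i alpha beta f t + b * Mderive i alpha beta g t) /\
  (* 2 *)
  (Mderivable i alpha beta (fun x => f x * g x) t /\
   Mderive i alpha beta (fun x => f x * g x) t =
     f t * Mderive i alpha beta g t + g t * Mderive i alpha beta f t) /\
  (* 3 *)
  (g t != 0 ->
   Mderivable i alpha beta (fun x => f x / g x) t /\
   Mderive i alpha beta (fun x => f x / g x) t =
     (g t * Mderive i alpha beta f t - f t * Mderive i alpha beta g t)
       / (g t) ^+ 2) /\
  (* 4 *)
  (forall c : R,
   Mderivable i alpha beta (fun _ => c) t /\
   Mderive i alpha beta (fun _ => c) t = 0) /\
  (* 5 *)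
  (derivable f t 1 ->
   Mderivable i alpha beta f t /\
   Mderive i alpha beta f t =
     t `^ (1 - alpha) / Gamma (beta + 1) * (f^`() t)%classic) /\
  (* 6 *)
  ((forall x : R, 0 <= x -> 0 <= g x) -> derivable_nneg f (g t) ->
   Mderivable i alpha beta (fun x => f (g x)) t /\
   Mderive i alpha beta (fun x => f (g x)) t =
     derive_nneg f (g t) * Mderive i alpha beta g t).
Proof.
have comp (h : R -> R) : (forall x, 0 <= x -> 0 <= h x) ->
    derivable_nneg f (h t) -> Mderivable i alpha beta h t ->
    Mderivable i alpha beta (f \o h) t /\
    Mderive i alpha beta (f \o h) t =
      derive_nneg f (h t) * Mderive i alpha beta h t.
  by move=> h0 fh hh; apply/cvg_MquotP/cvg_Mquot_comp.
split; first exact/cvg_MquotP/cvg_MquotD.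
split; first exact/cvg_MquotP/cvg_MquotM.
split; first by move=> gt0; exact/cvg_MquotP/cvg_Mquot_div.
split; first by move=> c; exact/cvg_MquotP/cvg_Mquot_cst.
split; last by move=> g0 fg; exact: comp.
move=> /(derivable_nnegE f ht) df.
have [did eid] := cvg_MquotP _ _ (cvg_Mquot_id _ _ alpha beta _ hi ht).
by have := comp id (fun _ => id) df did; rewrite eid derive_nnegE// mulrC.
Qed.
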